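(* Let $I=(\mathcal{A},\mathcal{O},W)$ be an add-MARA instance. Every Pareto-optimal allocation of $I$ is sequenceable.
   Context: An add-MARA instance is a triple $I=(\mathcal{A},\mathcal{O},W)$ where $\mathcal{A}=\{1,\dots,N\}$ is a nonempty finite set of agents, $\mathcal{O}=\{1,\dots,M\}$ is a nonempty finite set of objects, and $W:\mathcal{A}\times\mathcal{O}\to\mathbb{R}_{\ge 0}$ gives the weight $W(i,\ell)$ of object $\ell$ for agent $i$. The utility of agent $i$ for a share $S\subseteq\mathcal{O}$ is $u_i(S)=\sum_{\ell\in S}W(i,\ell)$. An allocation is a vector $\pi=\langle\pi_1,\dots,\pi_N\rangle$ of pairwise disjoint (possibly empty) subsets of $\mathcal{O}$ with $\bigcup_i\pi_i=\mathcal{O}$. An allocation $\pi'$ dominates $\pi$ if $u_i(\pi'_i)\ge u_i(\pi_i)$ for all agents $i$ and $u_j(\pi'_j)>u_j(\pi_j)$ for at least one agent $j$; $\pi$ is Pareto-optimal if no allocation dominates it. For $O\subseteq\mathcal{O}$ and an agent $i$, $\mathrm{best}(O,i)=\operatorname{argmax}_{\ell\in O}W(i,\ell)\subseteq O$ is the set of all objects of $O$ of maximal weight for $i$. A sequence of sincere choices is a vector $\sigma=(\sigma_1,\dots,\sigma_M)\in\mathcal{A}^M$. The sequence $\sigma$ generates $\pi$ if there are objects $o_1,\dots,o_M$ such that, with $\mathcal{O}_1=\mathcal{O}$ and $\mathcal{O}_{t+1}=\mathcal{O}_t\setminus\{o_t\}$, one has $o_t\in\mathrm{best}(\mathcal{O}_t,\sigma_t)$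 for $t=1,\dots,M$, and $\pi_i=\{o_t:\sigma_t=i\}$ for every agent $i$. An allocation is sequenceable if some sequence of sincere choices generates it. *)

(* Defs.v *)
From mathcomp Require Import all_boot all_order all_algebra.
From mathcomp Require Import reals.

Set Implicit Arguments.
Unset Strict Implicit.
Unset Printing Implicit Defensive.

Import Order.TTheory GRing.Theory Num.Theory.

Local Open Scope ring_scope.

Section AddMARA.

Variables (R : realType) (N M : nat).
(* W i l is the weight of object l for agent i.  Agents, objects and time
   steps are numbered from 0. *)
Implicit Types (W : 'I_N -> 'I_M -> R) (pi : {ffun 'I_N -> {set 'I_M}}).

Definition utility W (i : 'I_N) (S : {set 'I_M}) : R := \sum_(l in S) W i l.

Definition allocation pi : Prop :=
  (forall i j : 'I_N, i != j -> [disjoint pi i & pi j]) /\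
  \bigcup_(i < N) pi i = [set: 'I_M].

Definition dominates W pi' pi : Prop :=
  (forall i : 'I_N, utility W i (pi i) <= utility W i (pi' i)) /\
  (exists j : 'I_N, utility W j (pi j) < utility W j (pi' j)).

Definition pareto_optimal W pi : Prop :=
  ~ (exists pi', allocation pi' /\ dominates W pi' pi).

Definition best W (A : {set 'I_M}) (i : 'I_N) : {set 'I_M} :=
  [set l in A | [forall k in A, W i k <= W i l]].

(* A t is the set of objects still available before step t; only its values
   at t <= M are constrained. *)
Definition generates W (sigma : M.-tuple 'I_N) pi : Prop :=
  exists (o : M.-tuple 'I_M) (A : nat -> {set 'I_M}),
    [/\ A 0%N = [set: 'I_M],
        forall t : 'I_M, A t.+1 = A t :\ tnth o t,
        forall t : 'I_M, tnth o t \in best W (A t) (tnth sigma t)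
      & forall i : 'I_N, pi i = [set tnth o t | t : 'I_M & tnth sigma t == i]].

Definition sequenceable W pi : Prop :=
  exists sigma : M.-tuple 'I_N, generates W sigma pi.

End AddMARA.

(* Main.v *)
Require Import Defs.
From mathcomp Require Import all_boot all_order all_algebra.
From mathcomp Require Import fingroup perm reals.

(** Let objects be picked greedily: as long as some remaining object is a best
    remaining object for its owner, that owner picks it.  If the process gets
    stuck on a nonempty set [A], map each object of [A] to an object of [A]
    which its owner strictly prefers.  This map has a cycle in [A]; trading the
    objects along it gives a dominating allocation. *)

Local Open Scope ring_scope.

Import Order.TTheory GRing.Theory Num.Theory.

(** [B] is a minimal nonempty [f]-stable subset of [A], i.e. a cycle of [f]. *)
Lemma stable_set_perm (T : finType) (f : T -> T) (A : {set T}) :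
  A != set0 -> {in A, forall x, f x \in A} ->
  exists (p : {perm T}) (B : {set T}),
    [/\ B != set0, B \subset A & forall x, p x = if x \in B then f x else x].
Proof.
move=> A_neq0 fA.
pose P (B : {set T}) := (B != set0) && (f @: B \subset B).
have PA : P A.
  by rewrite /P A_neq0; apply/subsetP => _ /imsetP[x xA ->]; apply: fA.
have [B /minsetP[/andP[B_neq0 fB] minB] sBA] := minset_exists PA.
(* [f @: B] is again nonempty and stable, so minimality of [B] forces equality. Hence [f] preserves
   the cardinality of [B] and is injective on it. *)
have fBB : f @: B = B.
  apply: minB => //; rewrite /P imsetS // andbT.
  by have /set0Pn[x xB] := B_neq0; apply/set0Pn; exists (f x); apply: imset_f.
have f_inj : {in B &, injective f} by apply/imset_injP; rewrite fBB.
have fstab x : x \in B -> f x \in B by move=> xB; rewrite -fBB imset_f.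
have g_inj : injective (fun x => if x \in B then f x else x).
  move=> x y; case: ifPn => xB; case: ifPn => yB //.
  - exact: f_inj.
  - by move=> fxy; rewrite -fxy fstab in yB.
  - by move=> fxy; rewrite fxy fstab in xB.
by exists (perm g_inj), B; split=> // x; rewrite permE.
Qed.

Section ParetoOptimalAllocation.

Variables (R : realType) (N M : nat) (W : 'I_N -> 'I_M -> R).
Variable pi : {ffun 'I_N -> {set 'I_M}}.

Lemma allocation_owner :
  allocation pi ->
  exists own : 'I_M -> 'I_N, forall i l, (l \in pi i) = (own l == i).
Proof.
move=> [disj cover].
have /fin_all_exists[own ownP] l : exists i, l \in pi i.
  have : l \in \bigcup_(i < N) pi i by rewrite cover inE.
  by case/bigcupP => i _ li; exists i.
exists own => i l; apply/idP/eqP => [li | <- //].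
apply/eqP/negPn/negP => /disj/pred0P/(_ l)/=.
by rewrite ownP li.
Qed.

Lemma owner_allocation (own : 'I_M -> 'I_N) :
  allocation [ffun i => [set l | own l == i]].
Proof.
split=> [i j neq_ij | ].
  apply/pred0P => l /=; rewrite !ffunE !inE.
  by case: eqP => // ->; rewrite (negPf neq_ij).
apply/setP => l; rewrite inE; apply/bigcupP.
by exists (own l) => //; rewrite ffunE inE.
Qed.

(** This keeps the greedy picking from getting stuck: otherwise a trade within [A] would dominate
    [pi]. *)
Lemma pareto_best_owner (own : 'I_M -> 'I_N) (A : {set 'I_M}) :
  (forall i l, (l \in pi i) = (own l == i)) -> pareto_optimal W pi ->
  A != set0 -> exists2 l, l \in A & l \in best W A (own l).
Proof.
move=> ownP opt A_neq0.
have [/exists_inP // | /exists_inPn stuck] :=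
  boolP [exists l in A, l \in best W A (own l)].
(* Outside [A] the value of [f] is arbitrary. *)
have /fin_all_exists[f fP] l : exists k,
    l \in A -> k \in A /\ W (own l) l < W (own l) k.
  have [lA | _] := boolP (l \in A); last by exists l.
  have := stuck l lA; rewrite inE lA => /forall_inPn[k kA].
  by rewrite -ltNge; exists k.
have fA : {in A, forall l, f l \in A} by move=> l /fP[].
have [p [B [/set0Pn[b bB] /subsetP sBA pE]]] := stable_set_perm _ _ _ A_neq0 fA.
have ltp l : l \in B -> W (own l) l < W (own l) (p l).
  by move=> lB; rewrite pE lB; case: (fP l (sBA l lB)).
have lep l : W (own l) l <= W (own l) (p l).
  by have [/ltp/ltW // | lB] := boolP (l \in B); rewrite pE (negPf lB).
(* The owner of [l] gives up [l] and receives [p l], whence the inverse. *)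
pose pi' := [ffun i => [set l | own ((p^-1)%g l) == i]].
have utE i : utility W i (pi i) = \sum_(l | own l == i) W i l.
  by apply: eq_bigl => l; rewrite ownP.
have utE' i : utility W i (pi' i) = \sum_(l | own l == i) W i (p l).
  rewrite /utility (reindex_inj (@perm_inj _ p)).
  by apply: eq_bigl => l; rewrite ffunE inE permK.
case: opt; exists pi'; split; first exact: owner_allocation.
split=> [i | ].
  by rewrite utE utE'; apply: ler_sum => l /eqP <-.
(* The object [b] lies on the cycle, so its owner gains strictly there and loses nothing on the
   other objects. *)
exists (own b); rewrite utE utE' [ltLHS](bigD1 b) //= [ltRHS](bigD1 b) //=.
apply: ltr_leD; first exact: ltp.
by apply: ler_sum => l /andP[/eqP <- _].
Qed.

End ParetoOptimalAllocation.

Theorem proposition7 (R : realType) (N M : nat) (N_gt0 : (0 < N)%N)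
    (M_gt0 : (0 < M)%N) (W : 'I_N -> 'I_M -> R)
    (W_ge0 : forall (i : 'I_N) (l : 'I_M), 0 <= W i l)
    (pi : {ffun 'I_N -> {set 'I_M}}) :
  allocation pi -> pareto_optimal W pi -> sequenceable W pi.
Proof.
move=> /allocation_owner[own ownP] opt.
(* [c] is the greedy pick from each set of remaining objects; on the empty set it takes a dummy
   value, available since [0 < M]. *)
have /fin_all_exists[c cP] (A : {set 'I_M}) : exists l,
    A != set0 -> l \in A /\ l \in best W A (own l).
  have [-> | A_neq0] := eqVneq A set0; first by exists (Ordinal M_gt0).
  by have [l] := pareto_best_owner _ _ _ _ _ own A ownP opt A_neq0; exists l.
pose A := fix A t := if t is s.+1 then A s :\ c (A s) else [set: 'I_M].
have cardA t : (t <= M)%N -> #|A t| = (M - t)%N.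
  elim: t => [_ | t IH lt_tM]; first by rewrite /= cardsT card_ord subn0.
  have At_neq0 : A t != set0 by rewrite -card_gt0 IH ?subn_gt0 // ltnW.
  have [cA _] := cP _ At_neq0.
  have := cardsD1 (c (A t)) (A t).
  by rewrite cA IH 1?ltnW //= add1n subnS => ->.
have cA (t : 'I_M) : c (A t) \in best W (A t) (own (c (A t))).
  by case: (cP (A t)) => //; rewrite -card_gt0 cardA ?subn_gt0 // ltnW.
(* An object never picked would survive in [A M], which [cardA] shows to be empty. *)
have c_onto l : exists t : 'I_M, c (A t) = l.
  have [/existsP[t /eqP] | /existsPn missed] :=
    boolP [exists t : 'I_M, c (A t) == l]; first by exists t.
  have lA t : (t <= M)%N -> l \in A t.
    elim: t => [_ | t IH lt_tM] /=; first by rewrite inE.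
    by rewrite !inE IH 1?ltnW // andbT eq_sym (missed (Ordinal lt_tM)).
  have := lA M (leqnn M).
  by have /eqP := cardA M (leqnn M); rewrite subnn cards_eq0 => /eqP ->; rewrite inE.
(* At each step the agent to choose is the owner of the object picked. *)
exists [tuple own (c (A t)) | t < M], [tuple c (A t) | t < M], A.
split=> // [t | t | i]; rewrite ?tnth_mktuple //.
apply/setP => l; rewrite ownP; apply/idP/imsetP => [ownl | [t + ->]].
  by have [t cl] := c_onto l; exists t; rewrite ?inE tnth_mktuple cl.
by rewrite inE !tnth_mktuple.
Qed.
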